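(* Let Galilean spacetime be $\mathrm{ET}=\mathbf{R}^3\times\mathbf{R}$, with points $(r,t)$ and clock $\tau(r,t)=t$. A bijection $g:\mathrm{ET}\to \mathrm{ET}$ belongs to the Galilean group (that is, $g$ exchanges Galilean inertial motions, exchanges sheets of simultaneous events, and preserves the Euclidean structures of time and of the sheets of simultaneous events) if and only if there exist $A\in \mathrm{O}(3)$, $B,C\in\mathbf{R}^3$, $e\in\mathbf{R}$ and a sign $\varepsilon\in\{+1,-1\}$ such that $$g(r,t)=(Ar+Bt+C,\ \varepsilon t+e)\qquad\text{for all }(r,t)\in\mathbf{R}^3\times\mathbf{R}.$$ Equivalently, identifying $(r,t)$ with the column vector $(r,t,1)$, the Galilean group is the group of matrices $$\begin{pmatrix} A & B & C\\ 0 & \pm 1 & e\\ 0&0&1\end{pmatrix},\qquad A\in \mathrm{O}(3),\ B,C\in\mathbf{R}^3,\ e\in\mathbf{R}.$$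
   Context: Galilean spacetime is a $4$-dimensional real affine space with an affine clock $\tau$ onto the Euclidean time line $\mathrm{T}$ and Euclidean distances on the fibers of $\tau$ that are invariant under translations; coordinates are chosen so that it is $\mathbf{R}^3\times\mathbf{R}$, $\tau(r,t)=t$, $\mathrm{T}=\mathbf{R}$ has distance $|t'-t|$, and each sheet of simultaneous events $\mathrm{E}_t=\{(r,t)\mid r\in\mathbf{R}^3\}$ has distance $d_t((r,t),(r',t))=\|r'-r\|$ (standard Euclidean norm). A Galilean inertial motion is an affine line in $\mathrm{ET}$ transverse to $\tau$, i.e. not contained in any sheet $\mathrm{E}_t$ (a uniform rectilinear motion with finite velocity). The Galilean group is the set of transformations (bijections) $g$ of $\mathrm{ET}$ such that: (1) the image by $g$ of every Galilean inertial motion is a Galilean inertial motion; (2) the image by $g$ of every sheet of simultaneous events $\mathrm{E}_t$ is a sheet of simultaneous events $\mathrm{E}_{t'}$; (3) the induced map $t\mapsto t'$ on $\mathrm{T}$ preserves the distance of $\mathrm{T}$, and for each $t$ the restriction $g:\mathrm{E}_t\to \mathrm{E}_{t'}$ satisfies $d_{t'}(g(q),g(q'))=d_t(q,q')$ for all $q,q'\in \mathrm{E}_t$. *)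

(* Defs.v *)
From HB Require Import structures.
From mathcomp Require Import all_boot all_order all_algebra.
From mathcomp Require Import boolp classical_sets reals.

Set Implicit Arguments.
Unset Strict Implicit.
Unset Printing Implicit Defensive.

Import Order.TTheory GRing.Theory Num.Theory.

Local Open Scope classical_set_scope.
Local Open Scope ring_scope.

(* R^o rather than R, so that the product is an R-module. *)
Notation ET R := ('cV[R]_3 * R^o)%type.

Section GalileanSpacetime.
Variable R : realType.

Definition clock (q : ET R) : R := q.2.

Definition sheet (t : R) : set (ET R) := [set q | clock q = t].

(* MathComp-Analysis equips matrices with the sup norm, hence an explicit
   Euclidean norm. *)
Definition enorm (n : nat) (v : 'cV[R]_n) : R :=
  Num.sqrt (\sum_(i < n) v i 0 ^+ 2).

Definition time_dist (t t' : R) : R := `|t' - t|.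

(* The distance d_t of every sheet; only meaningful on simultaneous events. *)
Definition sheet_dist (q q' : ET R) : R := enorm (q'.1 - q.1).

Definition affine_line (V : lmodType R) (L : set V) : Prop :=
  exists p v : V, v != 0 /\ L = [set p + s *: v | s in [set: R]].

Definition inertial_motion (L : set (ET R)) : Prop :=
  affine_line L /\ forall t : R, ~ (L `<=` sheet t).

Definition preserves_inertial_motions (g : ET R -> ET R) : Prop :=
  forall L : set (ET R), inertial_motion L -> inertial_motion (g @` L).

(* h is the map induced on time by g; as sheets are nonempty, g has at most
   one induced map. *)
Definition induces_on_time (g : ET R -> ET R) (h : R -> R) : Prop :=
  forall t : R, g @` sheet t = sheet (h t).

Definition preserves_time_dist (h : R -> R) : Prop :=
  forall t t' : R, time_dist (h t) (h t') = time_dist t t'.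

Definition preserves_sheet_dist (g : ET R -> ET R) : Prop :=
  forall (t : R) (q q' : ET R), sheet t q -> sheet t q' ->
    sheet_dist (g q) (g q') = sheet_dist q q'.

Definition galilean (g : ET R -> ET R) : Prop :=
  [/\ bijective g,
      preserves_inertial_motions g
    & exists h : R -> R,
        [/\ induces_on_time g h, preserves_time_dist h
          & preserves_sheet_dist g]].

Definition orthogonal_group (n : nat) : set 'M[R]_n :=
  [set A | A^T *m A = 1%:M].

Definition sign (eps : R) : Prop := eps = 1 \/ eps = -1.

Definition hcoord (q : ET R) : 'cV[R]_(3 + 1 + 1) :=
  col_mx (col_mx q.1 (clock q)%:M) 1%:M.

Definition galilean_mx (A : 'M[R]_3) (B C : 'cV[R]_3) (eps e : R) :
    'M[R]_(3 + 1 + 1) :=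
  block_mx (block_mx A B 0 eps%:M) (col_mx C e%:M) 0 1%:M.

Definition galilean_matrices : set 'M[R]_(3 + 1 + 1) :=
  [set M | exists (A : 'M[R]_3) (B C : 'cV[R]_3) (eps e : R),
     [/\ orthogonal_group A, sign eps & M = galilean_mx A B C eps e]].

Definition mx_represents (M : 'M[R]_(3 + 1 + 1)) (g : ET R -> ET R) : Prop :=
  forall q : ET R, hcoord (g q) = M *m hcoord q.

(* A set of matrices that is a subgroup of GL_n. *)
Definition matrix_group (n : nat) (G : set 'M[R]_n) : Prop :=
  [/\ G `<=` [set M | M \in unitmx],
      G 1%:M,
      forall M N : 'M[R]_n, G M -> G N -> G (M *m N)
    & forall M : 'M[R]_n, G M -> G (invmx M)].

End GalileanSpacetime.

(* Main.v *)
(** To show that a Galilean [g] has the stated form, only the vertical inertial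
motions [{(r, s) | s}] are needed. As the induced
map on time is [s |-> eps * s + e], the position [(g (r, s)).1] on the image
line is affine in [s], say [a r + s *: b r]. Simultaneous distances are
preserved, so [(a r - a r') + s *: (b r - b r')] has constant norm in [s], which
forces [b r = b r' =: B]; and [a], being an isometry of Euclidean space, is
[r |-> A *m r + C] with [A] orthogonal. *)
Require Import Defs.
From HB Require Import structures.
From mathcomp Require Import all_boot all_order all_algebra.
From mathcomp Require Import boolp classical_sets reals.
From mathcomp Require Import ring lra.

Set Implicit Arguments.
Unset Strict Implicit.
Unset Printing Implicit Defensive.

Import Order.TTheory GRing.Theory Num.Theory.

Local Open Scope classical_set_scope.
Local Open Scope ring_scope.

(** * Isometries of Euclidean space are affine with orthogonal linear part *)

Section EuclideanIsometries.
Variables (R : realType) (n : nat).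
Implicit Types x y z : 'cV[R]_n.

Definition dot x y : R := \sum_(i < n) x i 0 * y i 0.

Lemma dotC x y : dot x y = dot y x.
Proof. by apply: eq_bigr => i _; rewrite mulrC. Qed.

Lemma dotDl x y z : dot (x + y) z = dot x z + dot y z.
Proof.
by rewrite -big_split; apply: eq_bigr => i _; rewrite !mxE mulrDl.
Qed.

Lemma dotZl (c : R) x y : dot (c *: x) y = c * dot x y.
Proof. by rewrite mulr_sumr; apply: eq_bigr => i _; rewrite !mxE mulrA. Qed.

Lemma dotDr x y z : dot z (x + y) = dot z x + dot z y.
Proof. by rewrite dotC dotDl !(dotC z). Qed.

Lemma dotZr (c : R) x y : dot x (c *: y) = c * dot x y.
Proof. by rewrite dotC dotZl dotC. Qed.

Lemma dotE x y : dot x y = (x^T *m y) 0 0.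
Proof. by rewrite !mxE; apply: eq_bigr => i _; rewrite !mxE. Qed.

Lemma dot_eq0 x : dot x x = 0 -> x = 0.
Proof.
move=> x0; apply/matrixP => i j; rewrite ord1 mxE; apply/eqP.
(* Squaring the coordinate makes it a term of a vanishing sum of nonnegative terms. *)
rewrite -[_ == 0]orbb -mulf_eq0; apply/eqP.
by apply: (psumr_eq0P _ x0) => // k _; rewrite -expr2 sqr_ge0.
Qed.

Lemma sqr_enorm x : enorm x ^+ 2 = dot x x.
Proof.
rewrite /enorm sqr_sqrtr; last by apply: sumr_ge0 => i _; rewrite sqr_ge0.
by apply: eq_bigr => i _; rewrite expr2.
Qed.

Lemma enormE x : enorm x = Num.sqrt (dot x x).
Proof. by congr Num.sqrt; apply: eq_bigr => i _; rewrite expr2. Qed.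

Lemma enorm_orthogonal (A : 'M[R]_n) x :
  orthogonal_group A -> enorm (A *m x) = enorm x.
Proof.
move=> AA; rewrite !enormE !dotE trmx_mul -mulmxA (mulmxA A^T).
by rewrite (AA : _ = _) mul1mx.
Qed.

(** The squared norm is a quadratic polynomial in [s] with leading coefficient [dot y y]. Its second
    difference over the values at -1, 0, 1 is [2 * dot y y], and it vanishes. *)
Lemma const_enorm_line x y (c : R) :
  (forall s : R, enorm (x + s *: y) = c) -> y = 0.
Proof.
move=> xy; apply: dot_eq0.
have sq s : dot (x + s *: y) (x + s *: y) = c ^+ 2 by rewrite -sqr_enorm xy.
move: (sq 0) (sq 1) (sq (-1)).
rewrite !(dotDl, dotDr, dotZl, dotZr) (dotC y x); lra.
Qed.

(** Polarization: as [f] fixes the origin it preserves norms, and the expansion of the squared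
    distance leaves only the cross term. *)
Lemma isometry_dot (f : 'cV[R]_n -> 'cV[R]_n) :
  f 0 = 0 -> (forall x y, enorm (f y - f x) = enorm (y - x)) ->
  forall x y, dot (f x) (f y) = dot x y.
Proof.
move=> f0 fP x y.
have sq u v : dot (f v - f u) (f v - f u) = dot (v - u) (v - u).
  by rewrite -!sqr_enorm fP.
have fn u : dot (f u) (f u) = dot u u by move: (sq 0 u); rewrite f0 !subr0.
move: (sq x y); rewrite -!scaleN1r !(dotDl, dotDr, dotZl, dotZr) !fn.
rewrite (dotC (f y)) (dotC y); lra.
Qed.

(** After translation to fix the origin, the images of the standard basis are orthonormal and form
    the columns of [A]. The dot products of [f x] with these columns are the coordinates of [x], so
    no linearity of [f] has to be shown beforehand. *)
Lemma isometry_affine (a : 'cV[R]_n -> 'cV[R]_n) :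
  (forall x y, enorm (a y - a x) = enorm (y - x)) ->
  exists2 A : 'M[R]_n, orthogonal_group A & forall x, a x = A *m x + a 0.
Proof.
move=> aP; pose f x := a x - a 0.
have fdot : forall x y, dot (f x) (f y) = dot x y.
  apply: isometry_dot; first by rewrite /f subrr.
  by move=> x y; rewrite /f opprB addrA subrK aP.
pose A : 'M[R]_n := \matrix_(i, j) f (delta_mx j 0) i 0.
have dot_delta i x : dot (delta_mx i 0) x = x i 0.
  by rewrite dotE trmx_delta -rowE mxE.
have Af x : A^T *m f x = x.
  apply/matrixP => i j; rewrite ord1 -[RHS]dot_delta -fdot mxE.
  by apply: eq_bigr => k _; rewrite !mxE.
have AA : A^T *m A = 1%:M.
  apply/matrixP => i j.
  transitivity (dot (f (delta_mx i 0)) (f (delta_mx j 0))).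
    by rewrite mxE; apply: eq_bigr => k _; rewrite !mxE.
  by rewrite fdot dot_delta !mxE eqxx andbT eq_sym.
exists A => // x.
(* Since [A] is square, [A *m A^T = 1%:M] too, and [A^T *m f x = x] gives [f x = A *m x]. *)
by rewrite -{2}(Af x) mulmxA (mulmx1C AA) mul1mx /f subrK.
Qed.

End EuclideanIsometries.

(** * Galilean transformations as affine maps *)

Section GalileanGroup.
Variable R : realType.
Implicit Types (A : 'M[R]_3) (B C r : 'cV[R]_3) (e eps t : R).
Implicit Types (g : ET R -> ET R) (M : 'M[R]_(3 + 1 + 1)).

Definition galilean_map A B C eps e (q : ET R) : ET R :=
  (A *m q.1 + q.2 *: B + C, eps * q.2 + e).

Lemma sign_sqr eps : sign eps -> eps * eps = 1.
Proof. by case=> ->; rewrite ?mulrNN mulr1. Qed.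

Lemma sqr1_sign eps : eps * eps = 1 -> sign eps.
Proof.
move=> e1; have /eqP : eps ^+ 2 = 1 by rewrite expr2.
by rewrite sqrf_eq1 => /orP[] /eqP; [left | right].
Qed.

Lemma time_isometry (h : R -> R) : preserves_time_dist h ->
  exists2 eps : R, sign eps & forall t, h t = eps * t + h 0.
Proof.
move=> hP.
have sq s t : (h t - h s) ^+ 2 = (t - s) ^+ 2.
  have hst : `|h t - h s| = `|t - s| := hP s t.
  by rewrite -real_normK ?num_real// hst real_normK ?num_real.
have e1 : (h 1 - h 0) * (h 1 - h 0) = 1 by have := sq 0 1; nra.
exists (h 1 - h 0); first exact: sqr1_sign.
move=> t; have st := sq 0 t; have s1 := sq 1 t.
(* Polarization in dimension one: the distances of [h t] to [h 0] and to [h 1] determine this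
   product. *)
have et : (h 1 - h 0) * (h t - h 0) = t by nra.
by rewrite -[X in _ * X]et mulrA e1 mul1r subrK.
Qed.

(** A line lies in a sheet exactly when its direction has zero time component; comparing the points
    of parameters 0 and 1 suffices. *)
Lemma inertial_motionP (L : set (ET R)) :
  inertial_motion L <->
  exists p v : ET R, v.2 != 0 /\ L = [set p + s *: v | s in [set: R]].
Proof.
split=> [[[p [v [_ ->]]] Lt] | [p [v [v0 ->]]]].
  exists p, v; split=> //; apply/eqP => v0; apply: (Lt p.2).
  by move=> _ [s _ <-]; rewrite /sheet /clock /= v0 scaler0 addr0.
split; first by exists p, v; split=> //; apply: contraNneq v0 => ->.
move=> t Lt; move/eqP: v0; apply.
have p0 : p.2 + 0 * v.2 = t by apply: (Lt (p + 0 *: v)); exists 0.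
have p1 : p.2 + 1 * v.2 = t by apply: (Lt (p + 1 *: v)); exists 1.
move: p0 p1; rewrite mul0r mul1r addr0 => -> /(canRL (addKr _)) ->.
by rewrite addNr.
Qed.

(** The image of the vertical line through [r] is transverse to the clock, so the parameter of an
    image point can be read off its time [h s], which is affine in [s]. *)
Lemma galilean_vertical g (h : R -> R) (eps : R) r :
  preserves_inertial_motions g -> induces_on_time g h ->
  (forall t, h t = eps * t + h 0) ->
  exists b, forall s : R, (g (r, s)).1 = (g (r, 0)).1 + s *: b.
Proof.
move=> gL gh hE.
have /gL/inertial_motionP[p [v [v0 imE]]] : inertial_motion
    [set ((r, 0) : ET R) + s *: ((0, 1) : ET R) | s in [set: R]].
  by apply/inertial_motionP; exists (r, 0), (0, 1); rewrite oner_neq0.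
have gE s : (g (r, s)).1 = p.1 + ((h s - p.2) / v.2) *: v.1.
  have : (g @` [set ((r, 0) : ET R) + s *: ((0, 1) : ET R) | s in [set: R]])
           (g (r, s)).
    exists (r, s) => //; exists s => //; congr pair => /=.
      by rewrite scaler0 addr0.
    by rewrite add0r; exact: mulr1.
  rewrite imE => -[u _ gu].
  have gs : (g (r, s)).2 = h s.
    by have : sheet (h s) (g (r, s)) by rewrite -gh; exists (r, s).
  rewrite -gs -gu /= [u *: v.2]/(u * v.2).
  by rewrite [p.2 + _]addrC addrK mulfK.
exists ((eps / v.2) *: v.1) => s.
rewrite !gE -addrA scalerA -scalerDl; congr (_ + _ *: _).
by rewrite hE; field.
Qed.

Lemma galilean_affine g : galilean g ->
  exists A B C e eps,
    [/\ orthogonal_group A, sign eps & g = galilean_map A B C eps e].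
Proof.
move=> [_ gL [h [gh hP gP]]].
have [eps epsP hE] := time_isometry hP.
have [b gE] := choice (fun r => galilean_vertical r gL gh hE).
have dist s r r' : enorm ((g (r', s)).1 - (g (r, s)).1) = enorm (r' - r).
  exact: (gP s (r, s) (r', s)).
have b0 r : b r = b 0.
  apply/eqP; rewrite -subr_eq0; apply/eqP.
  (* The images of [(r, s)] and [(0, s)] keep the distance [enorm (r - 0)] at every time [s]. *)
  apply: (@const_enorm_line _ _ ((g (r, 0)).1 - (g (0, 0)).1) _
            (enorm (r - 0))) => s.
  rewrite -(dist s) (gE r s) (gE 0 s).
  by rewrite scalerBr opprD addrACA.
have [A AO aE] := isometry_affine (dist 0).
exists A, (b 0), (g (0, 0)).1, (h 0), eps; split=> //.
apply/funext => -[r t]; rewrite /galilean_map /=.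
have gt : (g (r, t)).2 = h t.
  by have : sheet (h t) (g (r, t)) by rewrite -gh; exists (r, t).
by rewrite [LHS]surjective_pairing gt -hE gE b0 (aE r) addrAC.
Qed.

(** Bijectivity is assumed here and serves to show that sheets are mapped onto sheets; it is
    obtained below from the invertibility of the matrix. *)
Lemma galilean_map_galilean A B C eps e :
  orthogonal_group A -> sign eps -> bijective (galilean_map A B C eps e) ->
  galilean (galilean_map A B C eps e).
Proof.
move=> AO epsP bij.
have ee := sign_sqr epsP.
have eps0 : eps != 0.
  by apply/eqP => eps0; move/eqP: ee; rewrite eps0 mul0r eq_sym oner_eq0.
split=> //.
  move=> L /inertial_motionP[p [v [v0 ->]]]; apply/inertial_motionP.
  exists (galilean_map A B C eps e p), (A *m v.1 + v.2 *: B, eps * v.2).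
  split; first by rewrite mulf_neq0.
  have gE (s : R) : galilean_map A B C eps e (p + s *: v) =
      galilean_map A B C eps e p
        + s *: ((A *m v.1 + v.2 *: B, eps * v.2) : ET R).
    congr pair => /=.
      rewrite mulmxDr -scalemxAr [s *: v.2]/(s * v.2) scalerDl scalerDr.
      by rewrite -scalerA addrACA [LHS]addrAC.
    (* Scaling in [R^o] is multiplication by definition; [ring] needs it in that form. *)
    change (eps * (p.2 + s * v.2) + e = eps * p.2 + e + s * (eps * v.2)).
    by ring.
  apply/seteqP; split.
    by move=> _ [_ [s _ <-] <-]; exists s.
  by move=> _ [s _ <-]; exists (p + s *: v) => //; exists s.
exists (fun t => eps * t + e); split.
- move=> t; apply/seteqP; split; first by move=> _ [q <- <-].
  case: bij => f _ fK q qt; exists (f q) => //.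
  apply: (mulfI eps0); apply: (addIr e).
  by rewrite -qt -{2}(fK q).
- move=> t t'; rewrite /time_dist opprD addrACA subrr addr0 -mulrBr normrM.
  by case: epsP => ->; rewrite ?normrN normr1 mul1r.
move=> t q q' <- q't; rewrite /sheet_dist /=.
rewrite [q'.2](q't : _ = _) opprD addrACA subrr addr0 opprD addrACA subrr addr0.
by rewrite -mulmxBr enorm_orthogonal.
Qed.

(** * Homogeneous coordinates and the matrix of a Galilean map *)

Lemma hcoord_inj : injective (@hcoord R).
Proof.
move=> [r t] [r' t'] /eq_col_mx[/eq_col_mx[/= -> /matrixP/(_ 0 0)]].
by rewrite !mxE /clock /= !mulr1n => ->.
Qed.

Lemma galilean_mx_hcoord A B C eps e (q : ET R) :
  galilean_mx A B C eps e *m hcoord q = hcoord (galilean_map A B C eps e q).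
Proof.
rewrite /galilean_mx /hcoord /galilean_map /clock mul_block_col mulmx1.
rewrite mul0mx add0r mul1mx mul_block_col mul0mx add0r add_col_mx.
congr (col_mx (col_mx _ _) _); first by rewrite mul_mx_scalar.
by rewrite -[RHS]/((eps * (q.2 : R) + e)%:M) [RHS]raddfD /= scalar_mxM.
Qed.

Lemma mx_represents_galileanP A B C eps e g :
  mx_represents (galilean_mx A B C eps e) g <->
  g = galilean_map A B C eps e.
Proof.
split=> [gM | -> q]; last by rewrite galilean_mx_hcoord.
by apply/funext => q; apply: hcoord_inj; rewrite gM galilean_mx_hcoord.
Qed.

(** The value at [(0, 0)] gives [C] and [e], that at [(0, 1)] then gives [B] and [eps], and those at
    the basis vectors at time 0 give the columns of [A]. *)
Lemma galilean_map_inj A B C eps e A' B' C' eps' e' :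
  galilean_map A B C eps e = galilean_map A' B' C' eps' e' ->
  galilean_mx A B C eps e = galilean_mx A' B' C' eps' e'.
Proof.
move=> gE; have g_at q := congr1 (fun f => f q) gE.
have [] := g_at (0, 0).
rewrite /galilean_map /= !mulmx0 !scale0r !addr0 !add0r !mulr0 !add0r => <- <-.
have [] := g_at (0, 1).
rewrite /galilean_map /= !mulmx0 !scale1r !add0r !mulr1.
have [] := g_at (0, 0).
rewrite /galilean_map /= !mulmx0 !scale0r !addr0 !add0r !mulr0 !add0r => <- <-.
move=> /addIr <- /addIr <-.
have -> // : A = A'.
apply/matrixP => i j; have [] := g_at (delta_mx j 0, 0).
rewrite /galilean_map /= !scale0r !addr0.
have [] := g_at (0, 0).
rewrite /galilean_map /= !mulmx0 !scale0r !addr0 !add0r => <- _ /addIr.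
by rewrite -!colE => /matrixP/(_ i 0); rewrite !mxE.
Qed.

(** * Group structure of the Galilean matrices *)

Lemma galilean_mxM A B C eps e A' B' C' eps' e' :
  galilean_mx A B C eps e *m galilean_mx A' B' C' eps' e' =
  galilean_mx (A *m A') (A *m B' + eps' *: B) (A *m C' + e' *: B + C)
    (eps * eps') (eps * e' + e).
Proof.
rewrite /galilean_mx !mulmx_block !mulmx0 !mul0mx !mulmx1 !add0r !addr0.
rewrite mul_block_col mul0mx !add0r add_col_mx !mul_mx_scalar.
by rewrite !scale_scalar_mx -[in LHS](raddfD scalar_mx) !(mulrC eps).
Qed.

Lemma orthogonal_group1 n : orthogonal_group (1%:M : 'M[R]_n).
Proof. by rewrite /orthogonal_group /= trmx1 mul1mx. Qed.

Lemma orthogonal_groupM n (A B : 'M[R]_n) :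
  orthogonal_group A -> orthogonal_group B -> orthogonal_group (A *m B).
Proof.
move=> AO BO; rewrite /orthogonal_group /= trmx_mul -mulmxA (mulmxA A^T).
by rewrite (AO : _ = _) mul1mx.
Qed.

Lemma orthogonal_groupT n (A : 'M[R]_n) :
  orthogonal_group A -> orthogonal_group A^T.
Proof. by move=> AO; rewrite /orthogonal_group /= trmxK; apply: mulmx1C. Qed.

Lemma galilean_mx1 : galilean_mx 1%:M 0 0 1 0 = 1%:M :> 'M[R]_(3 + 1 + 1).
Proof.
by rewrite /galilean_mx -scalar_mx_block raddf0 col_mx0 -scalar_mx_block.
Qed.

Lemma galilean_matrices1 : galilean_matrices (1%:M : 'M[R]_(3 + 1 + 1)).
Proof.
exists 1%:M, 0, 0, 1, 0; split; [exact: orthogonal_group1 | by left |].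
by rewrite galilean_mx1.
Qed.

Lemma galilean_matricesM (M N : 'M[R]_(3 + 1 + 1)) :
  galilean_matrices M -> galilean_matrices N -> galilean_matrices (M *m N).
Proof.
move=> [A [B [C [eps [e [AO s ->]]]]]] [A' [B' [C' [eps' [e' [AO' s' ->]]]]]].
rewrite galilean_mxM; do 5 eexists; split; [| |by []].
  exact: orthogonal_groupM.
by apply: sqr1_sign; rewrite mulrACA (sign_sqr s) (sign_sqr s') mulr1.
Qed.

Lemma galilean_matrices_inv M : galilean_matrices M ->
  exists2 N, galilean_matrices N & M *m N = 1%:M.
Proof.
move=> [A [B [C [eps [e [AO s ->]]]]]].
(* Solving [(r', t') = (A r + t B + C, eps t + e)] gives [t = eps (t' - e)] and
   [r = A^T (r' - t B - C)], because [eps] and [A^T] are the inverses of [eps] and [A]. *)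
exists (galilean_mx A^T (- (eps *: (A^T *m B)))
         (- (A^T *m (C - (eps * e) *: B))) eps (- (eps * e))).
  by do 5 eexists; split; [exact: orthogonal_groupT AO | exact: s | by []].
rewrite galilean_mxM -galilean_mx1 (sign_sqr s) !mulmxN -scalemxAr !mulmxA.
rewrite (mulmx1C AO) !mul1mx addNr mulrN mulrA (sign_sqr s) mul1r addNr scaleNr.
by rewrite opprB [_ - C - _]addrAC subrr sub0r addNr.
Qed.

Lemma galilean_matrix_group : matrix_group (@galilean_matrices R).
Proof.
split.
- by move=> M /galilean_matrices_inv[N _ /mulmx1_unit[]].
- exact: galilean_matrices1.
- exact: galilean_matricesM.
move=> M /galilean_matrices_inv[N GN MN].
have [Mu _] := mulmx1_unit MN.
(* The right inverse [N], already a Galilean matrix, equals [invmx M]. *)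
by rewrite -[invmx M]mulmx1 -MN mulKmx.
Qed.

(** The inverse matrix is again of Galilean form, and its map is the inverse map since [hcoord] is
    injective. *)
Lemma galilean_map_bij A B C eps e :
  orthogonal_group A -> sign eps -> bijective (galilean_map A B C eps e).
Proof.
move=> AO s.
have [N [A' [B' [C' [eps' [e' [_ _ ->]]]]]] MN] :
    exists2 N, galilean_matrices N & galilean_mx A B C eps e *m N = 1%:M.
  by apply: galilean_matrices_inv; exists A, B, C, eps, e.
exists (galilean_map A' B' C' eps' e') => q; apply: hcoord_inj;
  by rewrite -!galilean_mx_hcoord mulmxA ?MN ?(mulmx1C MN) mul1mx.
Qed.

Lemma galileanP g : galilean g <->
  exists A B C e eps,
    [/\ orthogonal_group A, sign eps & g = galilean_map A B C eps e].
Proof.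
split; first exact: galilean_affine.
move=> [A [B [C [e [eps [AO s ->]]]]]].
by apply: galilean_map_galilean => //; apply: galilean_map_bij.
Qed.

End GalileanGroup.

Theorem mainTheorem3 (R : realType) :
  (forall g : ET R -> ET R, bijective g ->
     (galilean g <->
      exists (A : 'M[R]_3) (B C : 'cV[R]_3) (e eps : R),
        [/\ orthogonal_group A, sign eps
          & forall (r : 'cV[R]_3) (t : R),
              g (r, t) = (A *m r + t *: B + C, eps * t + e)]))
  /\
  [/\ matrix_group (galilean_matrices (R:=R)),
      forall g : ET R -> ET R, bijective g ->
        (galilean g <-> exists! M, galilean_matrices M /\ mx_represents M g),
      forall M, galilean_matrices M ->
        exists! g : ET R -> ET R, galilean g /\ mx_represents M g
    & forall (g h : ET R -> ET R) M N,
        mx_represents M g -> mx_represents N h ->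
        mx_represents (M *m N) (g \o h)].
Proof.
split=> [g _ |].
  split=> [/galileanP | ] [A [B [C [e [eps [AO s gE]]]]]].
    by exists A, B, C, e, eps; split=> // r t; rewrite gE.
  apply/galileanP; exists A, B, C, e, eps; split=> //.
  by apply/funext => -[r t]; rewrite gE.
split.
- exact: galilean_matrix_group.
- move=> g _; split.
    move=> /galileanP[A [B [C [e [eps [AO s gE]]]]]].
    exists (galilean_mx A B C eps e); split.
      by split; [exists A, B, C, eps, e | apply/mx_represents_galileanP].
    (* Uniqueness: a second Galilean matrix representing [g] has the same map, hence the same
       blocks. *)
    move=> _ [[A' [B' [C' [eps' [e' [_ _ ->]]]]]] /mx_represents_galileanP gE'].
    by apply: galilean_map_inj; rewrite -gE.
  move=> [_ [[[A [B [C [eps [e [AO s ->]]]]]] /mx_represents_galileanP gE] _]].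
  by apply/galileanP; exists A, B, C, e, eps.
- move=> _ [A [B [C [eps [e [AO s ->]]]]]].
  exists (galilean_map A B C eps e); split.
    split; last exact/mx_represents_galileanP.
    by apply/galileanP; exists A, B, C, e, eps.
  by move=> g [_ /mx_represents_galileanP].
by move=> g h M N gM hN q; rewrite /= gM hN mulmxA.
Qed.
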